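(* Let $X$ be a real Banach space with a bimonotone Schauder basis. If $X$ has the diameter 2 property (D2P) and $\varepsilon>0$, then the unit sphere $S_{X^{**}}$ of the bidual contains a line segment of length $>1-\varepsilon$; that is, there are $z_0,z_1\in X^{**}$ with $\|z_0-z_1\|>1-\varepsilon$ and $\|\lambda z_1+(1-\lambda)z_0\|=1$ for all $\lambda\in[0,1]$.
   Context: A Schauder basis $(e_k)_{k=1}^\infty$ of a Banach space $X$ is bimonotone if the projections $P_{[n,m]}\left(\sum_{k=1}^\infty a_k e_k\right)=\sum_{k=n}^m a_k e_k$ satisfy $\|P_{[n,m]}\|=1$ whenever $n\le m$. $X$ has the diameter 2 property (D2P) if every non-empty relatively weakly open subset of the closed unit ball $B_X$ has diameter 2. *)

(* Defs.v *)
From HB Require Import structures.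
From mathcomp Require Import all_boot all_order all_algebra.
From mathcomp Require Import all_classical all_reals all_analysis.
Set Implicit Arguments.
Unset Strict Implicit.
Unset Printing Implicit Defensive.
Import Order.TTheory GRing.Theory Num.Theory.
Import numFieldNormedType.Exports.
Local Open Scope classical_set_scope.
Local Open Scope ring_scope.

Definition unit_ball (R : realType) (V : normedModType R) : set V :=
  [set x | `|x| <= 1].

(* The value is +oo when f is unbounded on the unit ball. *)
Definition opnorm (R : realType) (V W : normedModType R) (f : V -> W) : \bar R :=
  ereal_sup [set `|f x|%:E | x in @unit_ball R V].

Section Dual.
Variables (R : realType) (V : normedModType R).

Definition dual_pred : {pred V -> R^o} :=
  mem [set f : V -> R^o | linear f /\ continuous f].

(* The carrier of V^*; the norm given to it below is opnorm. *)
Record dual := Dual {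
  dual_fun :> V -> R^o;
  dual_funP : dual_fun \in dual_pred }.

HB.instance Definition _ := [isSub for dual_fun].
HB.instance Definition _ := [Choice of dual by <:].

Lemma dual_submod_closed : submod_closed dual_pred.
Proof.
split=> [|a f g].
  rewrite inE; split; last exact: cst_continuous.
  by move=> a x y; rewrite scaler0 addr0.
rewrite !inE => -[lf cf] [lg cg]; split.
  move=> b x y; rewrite !fctE lf lg !scalerDr !scalerA (mulrC a b).
  by rewrite -!addrA; congr (_ + _); rewrite addrCA.
by move=> x; apply: cvgD; [apply: cvgZl_tmp; exact: cf|exact: cg].
Qed.

HB.instance Definition _ :=
  GRing.isSubmodClosed.Build R (V -> R^o) dual_pred dual_submod_closed.
HB.instance Definition _ := [SubChoice_isSubLmodule of dual by <:].

Lemma dual_linear (f : dual) : linear (f : V -> R^o).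
Proof. by have := dual_funP f; rewrite inE => -[]. Qed.

Lemma dual_continuous (f : dual) : continuous (f : V -> R^o).
Proof. by have := dual_funP f; rewrite inE => -[]. Qed.

HB.instance Definition _ (f : dual) :=
  GRing.isLinear.Build R V R^o _ (f : V -> R^o) (dual_linear f).

Lemma dual_bounded (f : dual) :
  exists2 M : R, 0 < M & forall x, `|f x| <= M * `|x|.
Proof.
have /linear_boundedP/pinfty_ex_gt0[M M0 fM] :
    bounded_near (f : {linear V -> R^o}) (nbhs (0 : V)).
  exact/linear_bounded_continuous/dual_continuous.
by exists M.
Qed.

Lemma opnorm_dual_fin_num (f : dual) : opnorm f \is a fin_num.
Proof.
have [M M0 fM] := dual_bounded f.
rewrite fin_real//; apply/andP; split.
  apply: (@lt_le_trans _ _ 0%E); first exact: ltNy0.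
  apply: ereal_sup_ubound; exists 0; first by rewrite /unit_ball/= normr0.
  by rewrite linear0 normr0.
apply: (@le_lt_trans _ _ M%:E); last exact: ltry.
apply: ub_ereal_sup => _ [x x1 <-]; rewrite lee_fin.
by apply: le_trans (fM x) _; rewrite ler_piMr// ltW.
Qed.

Definition dual_norm (f : dual) : R := fine (opnorm f).

Lemma dual_norm_ub (f : dual) x : `|f x| <= dual_norm f * `|x|.
Proof.
have [->|x0] := eqVneq x 0; first by rewrite linear0 !normr0 mulr0.
rewrite -ler_pdivrMr ?normr_gt0// -lee_fin fineK ?opnorm_dual_fin_num//.
apply: ereal_sup_ubound; exists (`|x|^-1 *: x).
  by rewrite /unit_ball/= normrZ normfV normr_id mulVf// normr_eq0.
by rewrite linearZ normrZ normfV normr_id mulrC.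
Qed.

Lemma dual_norm_le (f : dual) (M : R) :
  (forall x, `|x| <= 1 -> `|f x| <= M) -> dual_norm f <= M.
Proof.
move=> fM; rewrite -lee_fin fineK ?opnorm_dual_fin_num//.
by apply: ub_ereal_sup => _ [x x1 <-]; rewrite lee_fin fM.
Qed.

Lemma dual_norm_ge0 (f : dual) : 0 <= dual_norm f.
Proof.
rewrite -lee_fin fineK ?opnorm_dual_fin_num//.
apply: ereal_sup_ubound; exists 0; first by rewrite /unit_ball/= normr0.
by rewrite linear0 normr0.
Qed.

Lemma dual_normD (f g : dual) : dual_norm (f + g) <= dual_norm f + dual_norm g.
Proof.
apply: dual_norm_le => x x1; apply: le_trans (ler_normD (f x) (g x)) _.
by apply: lerD; apply: le_trans (dual_norm_ub _ x) _;
  rewrite ler_piMr// dual_norm_ge0.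
Qed.

Lemma dual_normZ_le (a : R) (f : dual) :
  dual_norm (a *: f) <= `|a| * dual_norm f.
Proof.
apply: dual_norm_le => x x1; rewrite [leLHS](normrM a (f x)) ler_wpM2l//.
by apply: le_trans (dual_norm_ub _ x) _; rewrite ler_piMr// dual_norm_ge0.
Qed.

Lemma dual_normZ (a : R) (f : dual) : dual_norm (a *: f) = `|a| * dual_norm f.
Proof.
apply/eqP; rewrite eq_le dual_normZ_le/=.
have [->|a0] := eqVneq a 0; first by rewrite normr0 mul0r dual_norm_ge0.
rewrite -ler_pdivlMl ?normr_gt0//.
by rewrite -{1}[f](scalerK a0) -normfV; exact: dual_normZ_le.
Qed.

Lemma dual_norm0_eq0 (f : dual) : dual_norm f = 0 -> f = 0.
Proof.
move=> f0; apply/val_inj/funext => x /=; apply/normr0_eq0/eqP.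
by rewrite eq_le normr_ge0 andbT (le_trans (dual_norm_ub f x))// f0 mul0r.
Qed.

HB.instance Definition _ :=
  Lmodule_isNormed.Build R dual dual_normD dual_normZ dual_norm0_eq0.

End Dual.

(* sigma(V, V^* ): the coarsest topology making every f : dual V continuous. *)
Definition weak_topology (R : realType) (V : normedModType R) : topologicalType :=
  sup_topology (fun f : dual V => Topological.on (initial_topology (f : V -> R^o))).

Definition diameter (R : realType) (V : normedModType R) (A : set V) : \bar R :=
  ereal_sup [set `|p.1 - p.2|%:E | p in A `*` A].

Definition D2P (R : realType) (V : normedModType R) : Prop :=
  forall U : set V, @open (weak_topology V) U ->
    U `&` @unit_ball R V !=set0 -> diameter (U `&` @unit_ball R V) = 2%:E.

Section SchauderBasis.
Variables (R : realType) (V : normedModType R) (e : nat -> V).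

Definition expansion_of (x : V) (a : nat -> R) : Prop :=
  series (fun k => a k *: e k) @ \oo --> x.

Definition schauder_basis : Prop := forall x, exists! a, expansion_of x a.

(* Meaningful when e is a Schauder basis; the default value is never used then. *)
Definition basis_coef (x : V) : nat -> R := xget (fun=> 0) (expansion_of x).

Definition basis_proj (n m : nat) (x : V) : V :=
  \sum_(n <= k < m.+1) basis_coef x k *: e k.

Definition bimonotone_basis : Prop :=
  schauder_basis /\
  forall n m : nat, (n <= m)%N -> opnorm (basis_proj n m) = 1%:E.

End SchauderBasis.

(* Main.v *)
From HB Require Import structures.
Require Import Defs.
From mathcomp Require Import all_boot all_order all_algebra.
From mathcomp Require Import all_classical all_reals all_analysis.
From mathcomp Require Import ring lra.
Import Order.TTheory GRing.Theory Num.Theory.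
Import numFieldNormedType.Exports.
Local Open Scope classical_set_scope.
Local Open Scope ring_scope.

(** By the D2P, a finitely supported [x] with [`|x| < 1] extends along the basis
    to a finitely supported [y] with [`|y| < 1] whose new block [y - x] has norm
    almost 1: the weakly open set of points whose first coordinates are close to
    those of [x] contains two points of the ball at distance almost 2, so the
    tail of one of them has norm almost 1.  Iterating gives partial sums [s n]
    in the ball, with [s 0 = 0], whose successive blocks have norms tending to 1
    and whose first block [s 1] has norm greater than [1 - eps].  Take for [z1]
    the limit of [s n] in the bidual along an ultrafilter, and for [z0] that of
    [s n - s 1].  Both lie in the ball by bimonotonicity, they differ by [s 1],
    and each point between them has the same blocks as [z1] after the first, so
    it has norm 1. *)

(** * Hahn-Banach for sublinear functionals on a real vector space *)

Section HahnBanach.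
Set Implicit Arguments.
Unset Strict Implicit.
Context {R : realType} {V : lmodType R}.
Implicit Types p q : V -> R.

(** Homogeneity is asked only as an inequality, which is easier to check; applying it to [a^-1]
    gives the equality in [sublinearZ]. *)
Definition sublinear p :=
  (forall x y, p (x + y) <= p x + p y) /\
  (forall a x, 0 <= a -> p (a *: x) <= a * p x).

Lemma sublinear0 p : sublinear p -> p 0 = 0.
Proof.
move=> [pD pZ]; have := pD 0 0; have := pZ 0 0 (lexx 0).
by rewrite addr0 scale0r mul0r; lra.
Qed.

Lemma sublinearZ p a x : sublinear p -> 0 <= a -> p (a *: x) = a * p x.
Proof.
move=> [pD pZ] a0; have [->|an0] := eqVneq a 0.
  by rewrite scale0r mul0r sublinear0.
apply/eqP; rewrite eq_le pZ//= -ler_pdivlMl ?lt_def ?an0//.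
by rewrite -{1}[x](scalerK an0) pZ// invr_ge0.
Qed.

Lemma sublinearN p x : sublinear p -> - p (- x) <= p x.
Proof.
by move=> sp; have := sp.1 x (- x); rewrite subrr sublinear0// => ?; lra.
Qed.

(** The lower bound [p] makes every infimum genuine. The index [k] may depend on the points, which
    covers both uses: sums of parameters in the straightening, and the smaller of two members of a
    chain. *)
Lemma sublinear_inf (I : Type) (A : set I) (F : I -> V -> R) p :
  A !=set0 ->
  (forall i, A i -> forall x, p x <= F i x) ->
  (forall i j x y, A i -> A j ->
    exists2 k, A k & F k (x + y) <= F i x + F j y) ->
  (forall i a x, A i -> 0 <= a -> exists2 k, A k & F k (a *: x) <= a * F i x) ->
  let q x := inf [set F i x | i in A] in
  sublinear q /\ forall i, A i -> forall x, q x <= F i x.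
Proof.
move=> [i0 Ai0] pF FD FZ q.
have qF i : A i -> forall x, q x <= F i x.
  move=> Ai x; apply: ge_inf; last by exists i.
  by exists (p x) => _ [j Aj <-]; exact: pF.
have qlb x c : (forall i, A i -> c <= F i x) -> c <= q x.
  move=> cF; apply: lb_le_inf; first by exists (F i0 x); exists i0.
  by move=> _ [i Ai <-]; exact: cF.
split=> //; split=> [x y|a x].
  rewrite -lerBlDr; apply: (qlb) => i Ai; rewrite lerBlDr -lerBlDl.
  apply: (qlb) => j Aj; rewrite lerBlDl.
  by have [k Ak] := FD i j x y Ai Aj; apply: le_trans; exact: qF.
rewrite le_eqVlt => /predU1P[<-|a0].
  have [k Ak] := FZ i0 0 x Ai0 (lexx 0); rewrite !mul0r; apply: le_trans.
  exact: qF.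
rewrite -ler_pdivrMl//; apply: (qlb) => i Ai; rewrite ler_pdivrMl//.
by have [k Ak] := FZ i a x Ai (ltW a0); apply: le_trans; exact: qF.
Qed.

(* The infimum of [p (x + t v) - t p v] over [t >= 0] is sublinear, lies below
   [p] and takes the value [- p v] at [- v]. *)
Lemma sublinear_straighten p v : sublinear p ->
  exists q, [/\ sublinear q, forall x, q x <= p x & q (- v) <= - p v].
Proof.
move=> sp; pose F t x := p (x + t *: v) - t * p v.
have [] := @sublinear_inf _ [set t | 0 <= t] F (fun x => - p (- x)).
- by exists 0 => /=.
(* Lower bound for [F]: [t * p v = p (t *: v) <= p (x + t *: v) + p (- x)]. *)
- move=> t /= t0 x; rewrite /F -(sublinearZ v sp t0).
  by have := sp.1 (x + t *: v) (- x); rewrite addrAC subrr add0r; lra.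
- move=> s t x y /= s0 t0; exists (s + t); first exact: addr_ge0.
  have := sp.1 (x + s *: v) (y + t *: v).
  by rewrite /F addrACA -scalerDl mulrDl; lra.
- move=> t a x /= t0 a0; exists (a * t); first exact: mulr_ge0.
  by rewrite /F -scalerA -scalerDr sublinearZ// mulrBr mulrA.
move=> sq qF; eexists; split; first exact: sq.
  by move=> x; apply: le_trans (qF 0 (lexx 0) x) _;
    rewrite /F scale0r addr0 mul0r subr0.
apply: le_trans (qF 1 ler01 _) _.
by rewrite /F scale1r addNr mul1r sublinear0// sub0r.
Qed.

(** Zorn's lemma for the reversed pointwise order on sublinear functionals below [p]: a nonempty
    chain is bounded by its pointwise infimum, finite because each member is at least [- p (- x)] at
    [x]. *)
Lemma minimal_sublinear p : sublinear p -> exists q,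
  [/\ sublinear q, forall x, q x <= p x &
      forall r, sublinear r -> (forall x, r x <= q x) -> r = q].
Proof.
move=> sp; pose T := {q | sublinear q /\ forall x, q x <= p x}.
pose below (q r : T) := `[< forall x, sval r x <= sval q x >].
have pp : sublinear p /\ forall x, p x <= p x by [].
have [| | | |[q [sq qp]] qmin] := @Zorn T below.
- by move=> q; exact/asboolP.
- move=> q r s /asboolP qr /asboolP rs; apply/asboolP => x.
  exact: le_trans (rs x) (qr x).
- move=> [q hq] [r hr] /asboolP /= qr /asboolP /= rq; apply: eq_exist.
  by apply/funext => x; apply/eqP; rewrite eq_le qr rq.
- move=> A Atot; have [->|/set0P[q0 Aq0]] := eqVneq A set0.
    by exists (exist _ p pp : T).
  have [] := @sublinear_inf T A (fun s x => sval s x) (fun x => - p (- x)).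
  + by exists q0.
  + move=> [q [sq qp]] _ x /=; apply: le_trans (sublinearN x sq).
    by rewrite lerN2.
  + move=> q r x y Aq Ar; have [/asboolP qr|/asboolP rq] := Atot _ _ Aq Ar.
      exists r => //; apply: le_trans ((svalP r).1.1 x y) _.
      by rewrite lerD2r.
    exists q => //; apply: le_trans ((svalP q).1.1 x y) _.
    by rewrite lerD2l.
  + by move=> q a x Aq a0; exists q => //; exact: (svalP q).1.2.
  set r := fun x : V => _ => sr rA.
  have rp : sublinear r /\ forall x, r x <= p x.
    by split=> // x; exact: le_trans (rA _ Aq0 x) ((svalP q0).2 x).
  by exists (exist _ r rp : T) => s As; apply/asboolP => x /=; exact: rA.
exists q; split=> // r sr rq.
have rp : sublinear r /\ forall x, r x <= p x.
  by split=> // x; exact: le_trans (rq x) (qp x).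
by have /(congr1 sval) := qmin (exist _ r rp : T) (asboolT rq).
Qed.

(* A minimal sublinear functional [q] is odd, as straightening it along [v]
   does not change it; a sublinear odd functional is linear. *)
Lemma hahn_banach p v : sublinear p ->
  exists f : V -> R^o, [/\ linear f, forall x, f x <= p x & f v = p v].
Proof.
(* Straightening along [v] first forces the value at [v]: a linear functional below [p'] is at most
   [- p v] at [- v], so at least [p v] at [v]. *)
move=> sp; have [p' [sp' p'p p'v]] := sublinear_straighten v sp.
have [q [sq qp' qmin]] := minimal_sublinear sp'.
have qN x : q (- x) = - q x.
  have [r [sr rq rx]] := sublinear_straighten x sq.
  rewrite (qmin r sr rq) in rx; apply/eqP; rewrite eq_le rx/=.
  by rewrite lerNl sublinearN.
have qp x : q x <= p x by exact: le_trans (qp' x) (p'p x).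
have qD x y : q (x + y) = q x + q y.
  apply/eqP; rewrite eq_le sq.1/=; have := sq.1 (x + y) (- y).
  by rewrite addrK qN; lra.
exists q; split=> //.
  move=> a x y; rewrite qD; congr (_ + _).
  have [a0|a0] := leP 0 a; first exact: sublinearZ.
  rewrite -[a]opprK scaleNr qN sublinearZ// ?oppr_ge0 ?ltW//.
  by rewrite scaleNr.
apply/eqP; rewrite eq_le qp/= -lerN2 -qN.
exact: le_trans (qp' _) p'v.
Qed.

End HahnBanach.

(** * Contractive and norming functionals *)

Section DualFunctionals.
Set Implicit Arguments.
Unset Strict Implicit.
Context {R : realType} {V : normedModType R}.

Lemma norm_dual_le (f : dual V) x : `|x| <= 1 -> `|f x| <= `|f|.
Proof.
move=> x1; apply: le_trans (dual_norm_ub f x) _.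
by rewrite ler_piMr ?dual_norm_ge0.
Qed.

Lemma dual_le (f : dual V) x : `|x| <= 1 -> (f x : R) <= `|f|.
Proof. by move=> /(norm_dual_le f); apply: le_trans; exact: ler_norm. Qed.

(** The one-sided bound at [x] and at [- x] gives [|f x| <= |x|], hence continuity. *)
Lemma contractive_dual (f : V -> R^o) : linear f ->
  (forall x, f x <= `|x|) -> exists2 g : dual V, `|g| <= 1 & g =1 f.
Proof.
move=> lf fub; pose F := GRing.isLinear.Build R V R^o _ f lf.
pose fl : {linear V -> R^o} := HB.pack f F.
have fx x : `|f x| <= `|x|.
  rewrite ler_norml fub andbT lerNl.
  by have <- := raddfN fl x; rewrite -normrN fub.
have cf : continuous f.
  apply: (@bounded_linear_continuous _ _ _ fl); apply/linear_boundedP.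
  exists 1; split=> // M M1 x; apply: le_trans (fx x) _.
  by rewrite ler_peMl// ltW.
have fP : f \in @dual_pred R V by rewrite inE; split.
exists (Dual fP) => //; apply: dual_norm_le => x x1.
exact: le_trans (fx x) x1.
Qed.

Lemma norming_functional (v : V) : exists2 f : dual V, `|f| <= 1 & f v = `|v|.
Proof.
have sn : sublinear (fun x : V => `|x|).
  by split=> [x y|a x a0]; [exact: ler_normD|rewrite normrZ ger0_norm].
have [f [lf fn fv]] := hahn_banach v sn.
by have [g g1 gf] := contractive_dual lf fn; exists g; rewrite ?gf.
Qed.

End DualFunctionals.

(** * Weakly open sets and the diameter 2 property *)

Section WeakOpen.
Set Implicit Arguments.
Unset Strict Implicit.
Context {R : realType} {V : normedModType R}.

Lemma dual_weak_continuous (f : dual V) :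
  continuous (f : weak_topology V -> R^o).
Proof.
move=> x; apply: (@cvg_comp _ _ _ id f _ (nbhs (x : initial_topology f))).
  by have /cvg_sup := @cvg_id _ (nbhs (x : weak_topology V)); apply.
exact: initial_continuous.
Qed.

Lemma weak_open_cylinder (n : nat) (f : nat -> dual V) (c : nat -> R) (r : R) :
  @open (weak_topology V)
    [set x | forall k, (k < n)%N -> `|f k x - c k| < r].
Proof.
elim: n => [|n IHn].
  by rewrite (_ : mkset _ = setT); [exact: openT|exact/seteqP].
have fn : @open (weak_topology V) [set x | `|f n x - c n| < r].
  apply: (@open_comp (weak_topology V) R^o (f n) [set y | `|y - c n| < r]).
    by move=> x _; exact: dual_weak_continuous.
  rewrite (_ : mkset _ = ball (c n) r); first exact: ball_open.
  by apply/seteqP; split=> y; rewrite /ball/= distrC.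
rewrite (_ : mkset _ = [set x | `|f n x - c n| < r] `&`
    [set x | forall k, (k < n)%N -> `|f k x - c k| < r]); first exact: openI.
apply/seteqP; split=> [x h|x [h1 h2] k].
  by split=> [|k kn]; apply: h => //; exact: leqW.
by rewrite ltnS leq_eqVlt => /predU1P[->//|]; exact: h2.
Qed.

(** The diameter is a supremum that need not be attained, hence the margin [r < 2]. *)
Lemma D2P_far_points (U : set V) (x : V) (r : R) : D2P V ->
  @open (weak_topology V) U -> U x -> `|x| <= 1 -> r < 2 ->
  exists y z, [/\ U y, U z, `|y| <= 1, `|z| <= 1 & r < `|y - z|].
Proof.
move=> d2 oU Ux x1 r2; have := d2 U oU.
move=> /(_ (ex_intro _ x (conj Ux x1))) dU.
have [_ [[y z] /= [[Uy y1] [Uz z1]] <-]] : exists2 d : \bar R,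
    [set `|p.1 - p.2|%:E | p in
      (U `&` @unit_ball R V) `*` (U `&` @unit_ball R V)] d &
    (r%:E < d)%E.
  by apply: ereal_sup_gt; rewrite -/(diameter _) dU lte_fin.
by rewrite lte_fin => ryz; exists y, z.
Qed.

End WeakOpen.

(** * Partial sums of a bimonotone basis and the block construction *)

Section BimonotoneBasis.
Set Implicit Arguments.
Unset Strict Implicit.
Context {R : realType} {V : normedModType R} {e : nat -> V}.
Hypothesis be : bimonotone_basis e.

Definition partial_sum n (x : V) : V :=
  series (fun k => basis_coef e x k *: e k) n.
Local Notation S := partial_sum.

Lemma basis_coefP x : expansion_of e x (basis_coef e x).
Proof. by have [a [ha _]] := be.1 x; apply: xgetPex; exists a. Qed.

Lemma partial_sum_cvg x : S n x @[n --> \oo] --> x.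
Proof. exact: basis_coefP. Qed.

Lemma basis_coef_eq x a : expansion_of e x a -> basis_coef e x = a.
Proof.
by have [b [_ hb]] := be.1 x => /hb <-; rewrite -(hb _ (@basis_coefP x)).
Qed.

(** By uniqueness of expansions, since the termwise combination of two expansions converges to the
    combination of the vectors. *)
Lemma basis_coef_linear k : linear (fun x => basis_coef e x k : R^o).
Proof.
move=> a x y /=; suff -> : basis_coef e (a *: x + y) =
  (fun k => a * basis_coef e x k + basis_coef e y k) by [].
apply: basis_coef_eq; rewrite /expansion_of.
rewrite (_ : series _ = fun n => a *: S n x + S n y).
  by apply: cvgD; [apply: cvgZl_tmp|]; exact: partial_sum_cvg.
apply/funext => n; rewrite /partial_sum/series/= scaler_sumr -big_split/=.
by apply: eq_bigr => i _; rewrite scalerDl scalerA.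
Qed.

Lemma partial_sum_linear n : linear (S n).
Proof.
move=> a x y; rewrite /partial_sum/series/= scaler_sumr -big_split/=.
apply: eq_bigr => i _; rewrite (basis_coef_linear i a x y) scalerDl scalerA.
by [].
Qed.

HB.instance Definition _ n :=
  GRing.isLinear.Build R V V _ (S n) (@partial_sum_linear n).

Lemma basis_coef_partial_sum n x k :
  basis_coef e (S n x) k = if (k < n)%N then basis_coef e x k else 0.
Proof.
suff -> : basis_coef e (S n x) =
  (fun k => if (k < n)%N then basis_coef e x k else 0) by [].
apply: basis_coef_eq; apply: cvg_near_cst; near=> m.
have nm : (n <= m)%N by near: m; exact: nbhs_infty_ge.
rewrite /partial_sum/series/= (big_cat_nat (leq0n _) nm)//=.
rewrite [X in _ + X]big_nat_cond [X in _ + X]big1 ?addr0.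
  by apply: eq_big_nat => i /andP[_ ->].
by move=> i /andP[/andP[ni _] _]; rewrite ltnNge ni scale0r.
Unshelve. all: by end_near. Qed.

Lemma partial_sum_comp m n x : S m (S n x) = S (minn m n) x.
Proof.
rewrite {1}/partial_sum /series/= /partial_sum/series/=.
have [mn|/ltnW nm] := leqP m n.
  apply: eq_big_nat => k /andP[_ km].
  by rewrite basis_coef_partial_sum (leq_trans km mn).
rewrite (big_cat_nat (leq0n _) nm)//= [X in _ + X]big_nat_cond.
rewrite [X in _ + X]big1 ?addr0.
  by apply: eq_big_nat => i /andP[_ ni]; rewrite basis_coef_partial_sum ni.
move=> i /andP[/andP[ni _] _].
by rewrite basis_coef_partial_sum ltnNge ni scale0r.
Qed.

Lemma partial_sumB m n x : (n <= m)%N ->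
  S m x - S n x = \sum_(n <= k < m) basis_coef e x k *: e k.
Proof.
move=> nm; rewrite /partial_sum/series/= (big_cat_nat (leq0n _) nm)//=.
by rewrite addrAC subrr add0r.
Qed.

Lemma norm_partial_sumB m n x : (n <= m)%N -> `|S m x - S n x| <= `|x|.
Proof.
move=> nm; have [->|x0] := eqVneq x 0; first by rewrite !linear0 addr0.
move: nm; rewrite leq_eqVlt => /predU1P[->|]; first by rewrite subrr normr0.
(* [basis_proj] includes its upper index and [partial_sum] excludes it, so [S m.+1 - S n] is
   [basis_proj e n m], of norm 1. *)
case: m => // m nm; have nx0 : 0 < `|x| by rewrite normr_gt0.
have [y y1 xy] : exists2 y, `|y| <= 1 & x = `|x| *: y.
  exists (`|x|^-1 *: x); last by rewrite scalerKV ?gt_eqF.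
  by rewrite normrZ normfV normr_id mulVf ?gt_eqF.
rewrite {1 2}xy !linearZ/= -scalerDr normrZ normr_id ler_piMr//.
rewrite partial_sumB 1?ltnW// -/(basis_proj e n m _) -lee_fin.
by rewrite -(be.2 n m nm); apply: ereal_sup_ubound; exists y.
Qed.

Lemma norm_partial_sum n x : `|S n x| <= `|x|.
Proof.
have := norm_partial_sumB x (leq0n n).
by rewrite {2}/partial_sum/series/= big_geq// subr0.
Qed.

(** With the factor [|e k|], the absolute value is the norm of a one-term block of [x], so at most
    [|x|]. This is also the quantity summed when estimating [S N y - S N x]. *)
Lemma scaled_basis_coef_dual k :
  exists f : dual V, forall x, f x = basis_coef e x k * `|e k|.
Proof.
pose f x : R^o := basis_coef e x k * `|e k|.
have lf : linear f.
  move=> a x y; rewrite /f (basis_coef_linear k a x y) mulrDl.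
  by rewrite [_ *: basis_coef _ _ _]/(_ * _) -mulrA.
have [|g _ gf] := contractive_dual lf; last by exists g.
move=> x; apply: le_trans (ler_norm _) _.
rewrite /f normrM normr_id -normrZ.
apply: le_trans (norm_partial_sumB x (leqnSn k)).
by rewrite partial_sumB// big_nat1.
Qed.

Lemma partial_sum_weakly_close N (x : V) (h : R) : 0 < h -> exists U : set V,
  [/\ @open (weak_topology V) U, U x &
      forall y, U y -> `|S N y - S N x| <= h].
Proof.
move=> h0; have [f fE] := choice scaled_basis_coef_dual.
(* Each of the [N] terms contributes at most [h / N.+1]; the successor keeps the divisor nonzero
   when [N = 0]. *)
exists [set y | forall k, (k < N)%N -> `|f k y - f k x| < h / N.+1%:R].
split; first exact: weak_open_cylinder.
  by move=> k _; rewrite subrr normr0 divr_gt0.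
move=> y Uy; rewrite /partial_sum/series/= !big_mkord -sumrB.
apply: le_trans (ler_norm_sum _ _ _) _.
apply: (@le_trans _ _ (\sum_(k < N) h / N.+1%:R)).
  apply: ler_sum => k _; rewrite -scalerBl normrZ -[X in _ * X]normr_id -normrM.
  by rewrite mulrBl -!fE ltW// Uy.
rewrite sumr_const card_ord -[_ *+ _]mulr_natr mulrAC -mulrA.
rewrite ler_piMr ?(ltW h0)//.
by rewrite ler_pdivrMr ?ltr0Sn// mul1r ler_nat.
Qed.

Lemma D2P_extend N (x : V) (d : R) : D2P V -> S N x = x -> `|x| < 1 -> 0 < d ->
  exists M y, [/\ (N <= M)%N, S M y = y, S N y = x, `|y| < 1 &
    1 - d < `|y - x|].
Proof.
move=> d2 xN x1 d0.
(* [|x| <= 1 - h] keeps [x' = x / (1 - h)] in the ball, and [4 * h <= d] gives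
   [1 - d <= (1 - h) * (1 - 2 * h)], the bound for the new block. *)
have [h [h0 h1 hx hd]] : exists h : R,
    [/\ 0 < h, h < 1, `|x| <= 1 - h & 4 * h <= d].
  exists (Num.min ((1 - `|x|) / 2) (d / 4)); have nx := normr_ge0 x.
  by case: (leP ((1 - `|x|) / 2) (d / 4)) => hh; split; lra.
pose t := 1 - h; have t0 : 0 < t by rewrite /t; lra.
pose x' := t^-1 *: x; have xE : x = t *: x' by rewrite scalerKV ?gt_eqF.
have x'1 : `|x'| <= 1.
  by rewrite normrZ gtr0_norm ?invr_gt0// ler_pdivrMl// mulr1.
have x'N : S N x' = x' by rewrite linearZ/= xN.
have [U [oU Ux' UN]] := partial_sum_weakly_close N x' h0.
rewrite x'N in UN.
have r2 : 2 - 2 * h < 2 by lra.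
have [y [z [Uy Uz y1 z1 yz]]] := D2P_far_points d2 oU Ux' x'1 r2.
(* If both tails had norm at most [1 - 2 * h], then, the heads being within [h] of [x'], [y] and [z]
   would be at distance at most [2 - 2 * h]. *)
have [w [Uw w1 wfar]] : exists w,
    [/\ U w, `|w| <= 1 & 1 - 2 * h < `|w - S N w|].
  have [yfar|yN] := ltP (1 - 2 * h) `|y - S N y|; first by exists y.
  have [zfar|zN] := ltP (1 - 2 * h) `|z - S N z|; first by exists z.
  have := ler_distD x' y z; rewrite (distrC x' z).
  have := ler_distD (S N y) y x'; have := ler_distD (S N z) z x'.
  by have := UN _ Uy; have := UN _ Uz; lra.
have wcvg : S M w - S N w @[M --> \oo] --> w - S N w.
  by apply: cvgB; [exact: partial_sum_cvg|exact: cvg_cst].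
near \oo => M.
have NM : (N <= M)%N by near: M; exact: nbhs_infty_ge.
have wM : 1 - 2 * h < `|S M w - S N w|.
  by near: M; apply: (cvgr_norm_gt _ wcvg).
exists M, (x + t *: (S M w - S N w)); split=> //.
- rewrite linearD linearZ linearB/= -{1}xN !partial_sum_comp minnn.
  by rewrite (minn_idPr NM) xN.
- rewrite linearD linearZ linearB/= !partial_sum_comp minnn (minn_idPl NM).
  by rewrite subrr scaler0 addr0.
(* The head of [w] is within [h] of [x'], so replacing it costs [h], and [(1 - h) * (1 + h) < 1]. *)
- rewrite xE -scalerDr normrZ gtr0_norm//.
  have : `|x' + (S M w - S N w)| <= 1 + h.
    rewrite addrC -addrA; apply: le_trans (ler_normD _ _) _; apply: lerD.
      exact: le_trans (norm_partial_sum _ _) w1.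
    by rewrite addrC distrC UN.
  rewrite -(ler_pM2l t0) => /le_lt_trans; apply; rewrite /t; nra.
- rewrite addrAC subrr add0r normrZ gtr0_norm//.
  move: wM; rewrite -(ltr_pM2l t0); apply: le_lt_trans; rewrite /t; nra.
Unshelve. all: by end_near. Qed.

(** The identity with [minn] says that the [s n] are truncations of one formal series. *)
Lemma D2P_block_sequence (eps : R) : D2P V -> 0 < eps ->
  exists (N : nat -> nat) (s : nat -> V), [/\ s 0%N = 0,
    forall n m, (n <= m)%N -> (N n <= N m)%N,
    forall n m, S (N n) (s m) = s (minn n m),
    forall n, `|s n| < 1 &
    forall n, 1 - eps / n.+1%:R < `|s n.+1 - s n|].
Proof.
move=> d2 eps0.
(* A state holds the step number, a bound on the support and the vector; the number is carried
   because the tolerance [eps / n.+1] depends on it. *)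
pose T := {a : nat * nat * V | S a.1.2 a.2 = a.2 /\ `|a.2| < 1}.
pose r (a b : T) := let: (n, N, x) := sval a in let: (m, M, y) := sval b in
  [/\ m = n.+1, (N <= M)%N, S N y = x & 1 - eps / n.+1%:R < `|y - x|].
have step (a : T) : {b : T | r a b}.
  apply: cid; case: a => -[[n N] x] [/= xN x1].
  have dn : 0 < eps / n.+1%:R by rewrite divr_gt0.
  have [M [y [NM yM yN y1 yx]]] := D2P_extend d2 xN x1 dn.
  by exists (exist _ (n.+1, M, y) (conj yM y1)).
have z0 : S 0%N 0 = 0 /\ `|0 : V| < 1 by rewrite linear0 normr0.
have [g [g0 gr]] := dependent_choice step (exist _ (0%N, 0%N, 0 : V) z0 : T).
pose N n := (sval (g n)).1.2; pose s n := (sval (g n)).2.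
have gn n : (sval (g n)).1.1 = n.
  elim: n => [|n IHn]; first by rewrite g0.
  by move: (gr n); rewrite /r -[in RHS]IHn; case: (sval (g n)) (sval (g n.+1))
    => -[? ?] ? -[[? ?] ?] [].
have gN n : [/\ (N n <= N n.+1)%N, S (N n) (s n.+1) = s n &
    1 - eps / n.+1%:R < `|s n.+1 - s n|].
  move: (gr n) (gn n); rewrite /r /N /s.
  by case: (sval (g n)) (sval (g n.+1)) => -[? ?] ? -[[? ?] ?] [_ ? ? ?] /= <-.
have Nle n m : (n <= m)%N -> (N n <= N m)%N.
  move: n m; apply: (@homo_leq _ N leq) => [//||n]; first exact: leq_trans.
  by have [] := gN n.
have sP n : S (N n) (s n) = s n by exact: (svalP (g n)).1.
have sN n m : (n <= m)%N -> S (N n) (s m) = s n.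
  elim: m => [|m IHm]; first by rewrite leqn0 => /eqP ->.
  rewrite leq_eqVlt => /predU1P[->//|]; rewrite ltnS => nm.
  have [_ sm _] := gN m.
  by rewrite -[RHS]IHm// -sm partial_sum_comp (minn_idPl (Nle _ _ nm)).
exists N, s; split=> [|//|n m|n|n].
- by rewrite /s g0.
- have [nm|/ltnW mn] := leqP n m; first exact: sN.
  by rewrite -(sP m) partial_sum_comp (minn_idPr (Nle _ _ mn)).
- exact: (svalP (g n)).2.
- by have [] := gN n.
Qed.
(** By bimonotonicity, a norming functional stays contractive when composed with the projection on a
    block; it then ignores all other coordinates. *)
Lemma norming_slice m n (v : V) : (n <= m)%N -> exists f g : dual V,
  [/\ `|g| <= 1, f v = `|v| & forall x, g x = f (S m x - S n x)].
Proof.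
move=> nm; have [f f1 fv] := norming_functional v.
have [||g g1 gE] := @contractive_dual _ _ (fun x => f (S m x - S n x)).
- move=> a x y; rewrite (partial_sum_linear m a x y).
  rewrite (partial_sum_linear n a x y).
  by rewrite opprD addrACA -scalerBr linearP.
- move=> x; apply: le_trans (ler_norm _) _.
  apply: le_trans (dual_norm_ub f _) _.
  apply: le_trans (norm_partial_sumB x nm).
  by rewrite ler_piMl.
- by exists f, g.
Qed.

End BimonotoneBasis.

(** * Weak-star limits in the bidual along an ultrafilter *)

Section WeakStarLimits.
Set Implicit Arguments.
Unset Strict Implicit.
Context {R : realType} {V : normedModType R} {T : Type}.

Lemma ultra_bounded_cvg (U : set_system T) (u : T -> R) (M : R) :
  UltraFilter U -> (forall i, `|u i| <= M) ->
  exists l : R, u i @[i --> U] --> l.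
Proof.
move=> UU uM; have [G [GU UG]] := @ultraFilterLemma _ (u i @[i --> U]) _.
have := @segment_compact R (- M) M; rewrite compact_ultra.
move=> /(_ G GU)[|l [_ Gl]].
  by apply: UG; apply: (@filterE _ U) => i /=; rewrite in_itv/= -ler_norml.
exists l => A lA; have [//|UnA] := in_ultra_setVsetC (u @^-1` A) UU.
have GnA : G (~` A) by apply: UG.
have := @filterI _ G _ _ _ (Gl _ lA) GnA; rewrite setICr => G0.
by have [] := filter_ex (G0 _).
Qed.

(** Pointwise limits along [U] preserve linearity in [f] and the bound by [|f|], so they define an
    element of the bidual. *)
Lemma bounded_weak_star_limit (U : set_system T) (x : T -> V) :
  UltraFilter U -> (forall i, `|x i| <= 1) ->
  exists z : dual (dual V), forall f : dual V, f (x i) @[i --> U] --> (z f : R).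
Proof.
move=> UU x1.
have fx (f : dual V) i : `|f (x i)| <= `|f| by exact: norm_dual_le.
have /choice[z zP] : forall f : dual V, exists l : R,
    f (x i) @[i --> U] --> l.
  by move=> f; exact: ultra_bounded_cvg (fx f).
have zl : linear (z : dual V -> R^o).
  move=> a f g; apply: (cvg_unique _ (zP (a *: f + g))) => //.
  have -> : (fun i => (a *: f + g) (x i)) =
    (fun i => a * f (x i) + g (x i)) by [].
  by apply: cvgD; [apply: cvgMl_tmp; exact: zP|exact: zP].
have [|Z _ Zz] := contractive_dual zl.
  move=> f; apply: (cvgr_to_le (zP f)); apply: (@filterE _ U) => i.
  exact: le_trans (ler_norm _) (fx f i).
by exists Z => f; rewrite Zz.
Qed.

End WeakStarLimits.

(** * The segment in the sphere of the bidual *)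

Theorem proposition2p10 (R : realType) (X : completeNormedModType R)
    (e : nat -> X) (eps : R) :
  bimonotone_basis e -> D2P X -> 0 < eps ->
  exists z0 z1 : dual (dual X),
    1 - eps < `|z0 - z1| /\
    forall lambda : R, 0 <= lambda <= 1 ->
      `|lambda *: z1 + (1 - lambda) *: z0| = 1.
Proof.
move=> be d2 eps0.
have [N [s [s0 Nle sN s1 sfar]]] := D2P_block_sequence be d2 eps0.
have sN1 m : `|s m.+1 - s 1%N| <= 1.
  have := norm_partial_sumB be (s m.+1) (Nle 1%N m.+1 isT).
  rewrite !sN minnn (minn_idPl (ltn0Sn m)) => /le_trans; apply; exact: ltW.
(* [U] contains every cofinite set of indices, so limits along it depend only on the tails of
   sequences. *)
have [U [UU oU]] := ultraFilterLemma (eventually_filter).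
have [z1 z1P] := @bounded_weak_star_limit _ _ _ U (fun m => s m.+1) UU
  (fun m => ltW (s1 m.+1)).
have [z0 z0P] := @bounded_weak_star_limit _ _ _ U
  (fun m => s m.+1 - s 1%N) UU sN1.
exists z0, z1; split.
  have [f f1 fs] := norming_functional (s 1%N).
  have -> : 1 - eps = 1 - eps / 1%:R by rewrite divr1.
  apply: lt_le_trans (sfar 0%N) _; rewrite s0 subr0 -fs.
  have <- : (z1 - z0) f = f (s 1%N).
    have fB : f (s m.+1) - f (s m.+1 - s 1%N) @[m --> U] --> z1 f - z0 f.
      exact: cvgB.
    apply: (cvg_unique _ fB) => //; apply: cvg_near_cst.
    by apply: (@filterE _ U) => m; rewrite linearB/= subKr.
  by rewrite distrC; exact: dual_le.
move=> l /andP[l0 l1].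
set z := _ + _.
(* [z] is the weak-star limit of [s m.+1] with its first block scaled by [l]. *)
have zP (f : dual X) : f (s m.+1 - (1 - l) *: s 1%N) @[m --> U] --> (z f : R).
  have fD : l * f (s m.+1) + (1 - l) * f (s m.+1 - s 1%N) @[m --> U]
      --> l * z1 f + (1 - l) * z0 f.
    by apply: cvgD; apply: cvgMl_tmp.
  suff -> : (fun m => f (s m.+1 - (1 - l) *: s 1%N)) =
    (fun m => l * f (s m.+1) + (1 - l) * f (s m.+1 - s 1%N)) by [].
  apply/funext => m; rewrite !linearB linearZ/=.
  have conv (a b : R) : a - (1 - l) * b = l * a + (1 - l) * (a - b) by ring.
  exact: conv.
apply/eqP; rewrite eq_le; apply/andP; split.
  apply: dual_norm_le => f f1; apply: (cvgr_to_le (cvg_norm (zP f))).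
  apply: (@filterE _ U) => m /=;   apply: le_trans f1; apply: norm_dual_le.
  rewrite (_ : _ - _ = l *: s m.+1 + (1 - l) *: (s m.+1 - s 1%N)); last first.
    by rewrite scalerBr addrA -scalerDl subrKC scale1r.
  apply: le_trans (ler_normD _ _) _; rewrite !normrZ !ger0_norm ?subr_ge0//.
  by have := sN1 m; have := s1 m.+1; nra.
apply/ler_addgt0Pr => d d0.
(* The block [s n.+2 - s n.+1] has tolerance [eps / n.+2]; it lies beyond the first block, the only
   one that [l] affects. *)
have [n epsn] : exists n, eps / n.+2%:R <= d.
  exists (Num.truncn (eps / d)); rewrite ler_pdivrMr// mulrC -ler_pdivrMr//.
  by apply: ltW; apply: lt_trans (truncnS_gt _) _; rewrite ltr_nat.
have [f [g [g1 fv gE]]] :=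
  norming_slice be (s n.+2 - s n.+1) (Nle _ _ (leqnSn n.+1)).
rewrite -lerBlDr; apply: (@le_trans _ _ `|s n.+2 - s n.+1|).
  by apply: le_trans (ltW (sfar n.+1)); rewrite lerD2l lerN2.
have <- : z g = `|s n.+2 - s n.+1|.
  apply: (cvg_unique _ (zP g)) => //; apply: cvg_near_cst.
  (* Once [n < m], [g] sees the whole block in [s m.+1] and vanishes on [s 1], so the values are
     constant. *)
  have : \forall m \near U, (n < m)%N by apply: oU; exact: nbhs_infty_gt.
  apply: filterS => m nm; rewrite linearB linearZ/= !gE !sN.
  rewrite (minn_idPl (_ : n.+2 <= m.+1)%N)//.
  rewrite (minn_idPl (_ : n.+1 <= m.+1)%N) 1?ltnW//.
  by rewrite !(minn_idPr (_ : 1 <= _)%N)// subrr linear0 scaler0 subr0 fv.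
exact: dual_le.
Qed.
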